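(* Let $K$ and $L$ be compact spaces, $K$ locally connected, and $p\colon K\to L$ continuous and surjective. Then the following assertions are equivalent. (a) $p$ is monotone. (b) For every connected set $C\subset L$ the preimage $p^{-1}(C)$ is connected. (c) For every open, connected set $U\subset L$ the preimage $p^{-1}(U)$ is connected. (d) For every irreducible $f\in C(L)$ the set $p^{-1}([f\neq 0])$ is connected. (e) $T_p$ preserves irreducibility of functions, i.e. $T_pf\in C(K)$ is irreducible for every irreducible $f\in C(L)$. (f) The subalgebra $\mathcal{A}_L=T_p(C(L))\subset C(K)$ satisfies $\operatorname{irr}(\mathcal{A}_L)\subset\mathcal{A}_L$.
   Context: Compact spaces are Hausdorff; $C(K)$ is the space of continuous complex-valued functions on $K$. A map $p\colon X\to Y$ of topological spaces is monotone if for each $y\in Y$ the preimage $p^{-1}(y)$ is a connected subset of $X$. $T_p\colon C(L)\to C(K)$, $f\mapsto f\circ p$, is the Koopman operator of $p$. $[f\neq 0]=\{x\mid f(x)\neq 0\}$. Functions $f,g\in C(K)$ are orthogonal if $|f|\wedge|g|=0$, equivalently $fg=0$; a decomposition $f=g+h$ in $C(K)$ is orthogonal if $g$ and $h$ are orthogonal. A function $f\in C(K)$ is reducible if $f=0$ or if there is an orthogonal decomposition $f=g+h$ with nonzero $g,h\in C(K)$; otherwise it is irreducible. If $f=g+h$ is an orthogonal decomposition and $g$ is irreducible, $g$ is an irreducible part of $f$; $\operatorname{irr}(f)$ is the set of irreducible parts of $f$, and $\operatorname{irr}(\mathcal{F})=\bigcup_{f\in\mathcal{F}}\operatorname{irr}(f)$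 for $\mathcal{F}\subset C(K)$. *)

(* Defs.v *)
From HB Require Import structures.
From mathcomp Require Import all_boot all_order all_algebra.
From mathcomp Require Import complex.
From mathcomp Require Import all_classical all_reals topology normedtype.

Set Implicit Arguments.
Unset Strict Implicit.
Unset Printing Implicit Defensive.

Import Order.TTheory GRing.Theory Num.Theory.
Import numFieldNormedType.Exports.

Local Open Scope classical_set_scope.
Local Open Scope ring_scope.

Definition locally_connected (T : topologicalType) : Prop :=
  forall (x : T) (U : set T), nbhs x U ->
    exists V : set T, [/\ open V, V x, connected V & V `<=` U].

Definition monotone_map (X Y : topologicalType) (p : X -> Y) : Prop :=
  forall y : Y, connected (p @^-1` [set y]).

(* The regular module [R[i]^o] is the complex field with the topology of its
   norm; [R[i]] itself carries no topology in the library. *)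
Definition CFun (R : realType) (K : topologicalType) : Type :=
  continuousType K R[i]^o.

Definition koopman (R : realType) (K L : topologicalType)
    (p : continuousType K L) (f : CFun R L) : CFun R K :=
  f \o p.

Section Irreducibility.
Context (R : realType) (K : topologicalType).
Implicit Types (f g h : CFun R K) (A : set (CFun R K)).

(* [`|z|] lives in [R[i]], whose order is partial; the two moduli are
   nonnegative, hence comparable, so [Num.min] is their infimum. *)
Definition orthogonal_fun f g : Prop :=
  forall x : K, Num.min `|f x| `|g x| = 0.

Lemma orthogonal_funP f g :
  orthogonal_fun f g <-> (forall x : K, f x * g x = 0).
Proof.
split=> fg x; have := fg x; rewrite /Num.min.
  by case: ifP => _ /normr0_eq0 ->; rewrite ?mul0r ?mulr0.
move=> /eqP; rewrite mulf_eq0 => /orP[] /eqP ->; rewrite normr0.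
  by case: ifPn => //; rewrite normr_gt0 negbK => /eqP ->; rewrite normr0.
by rewrite normr_lt0.
Qed.

Definition orthogonal_decomposition f g h : Prop :=
  f = g \+ h :> (K -> R[i]^o) /\ orthogonal_fun g h.

Definition reducible f : Prop :=
  f = cst 0 :> (K -> R[i]^o) \/
  exists g h, [/\ orthogonal_decomposition f g h,
                  g <> cst 0 :> (K -> R[i]^o) & h <> cst 0 :> (K -> R[i]^o)].

Definition irreducible f : Prop := ~ reducible f.

Definition irr f : set (CFun R K) :=
  [set g | irreducible g /\ exists h, orthogonal_decomposition f g h].

Definition irr_set A : set (CFun R K) := \bigcup_(f in A) irr f.

End Irreducibility.

(* Main.v *)
Require Import Defs.
From HB Require Import structures.
From mathcomp Require Import all_boot all_order all_algebra.
From mathcomp Require Import complex.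
From mathcomp Require Import all_classical all_reals topology normedtype.

Set Implicit Arguments.
Unset Strict Implicit.
Unset Printing Implicit Defensive.

Import Order.TTheory GRing.Theory Num.Theory.
Import numFieldNormedType.Exports.

Local Open Scope classical_set_scope.
Local Open Scope ring_scope.

(** A continuous function is irreducible exactly when its cozero set is nonempty
    and connected ([irreducibleP]): orthogonal decompositions of [f] amount to
    splittings of [cozero f] into two disjoint open sets, as restricting [f] to
    one of the pieces keeps it continuous ([continuous_restrict]). Since
    [cozero (koopman p f)] is the preimage of [cozero f], the assertions about
    functions become assertions about preimages of connected open sets.

    For monotone [p], preimages of connected sets are connected because [p] is
    a closed map and relatively clopen parts of a preimage are unions of fibers
    ([monotone_preimage_connected]). The conditions on connected sets, on
    connected open sets and on cozero sets of irreducible functions then follow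
    from each other by specialization, and the last one is the preservation of
    irreducibility.

    The remaining two steps need local connectedness, which makes the components
    of a cozero set relatively clopen, so that they carry irreducible parts
    ([component_part]). It passes from [K] to the quotient [L]
    ([locally_connected_image]); there it shows that, when irreducibility is
    preserved, an irreducible part of [koopman p f] is the image of an
    irreducible part of [f] ([irr_koopman_range]). Conversely, a disconnected
    fiber gives a bump function on [L] whose composition with [p] has an
    irreducible part living on only one piece of the fiber, which therefore does
    not factor through [p] ([irr_range_monotone]). *)

(** * Separation of open and closed sets, components *)

Section Topology.
Context {T : topologicalType}.
Implicit Types (A C U V : set T).

Lemma separated_open U V :
  open U -> open V -> U `&` V = set0 -> separated U V.
Proof.
move=> oU oV UV0; split; rewrite -subset0 => x [].
- move=> clUx Vx; have := clUx V (open_nbhs_nbhs (conj oV Vx)).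
  by rewrite UV0 => -[].
- move=> Ux clVx; have := clVx U (open_nbhs_nbhs (conj oU Ux)).
  by rewrite setIC UV0 => -[].
Qed.

Lemma connected_sub_open U V C : open U -> open V -> U `&` V = set0 ->
  C `<=` U `|` V -> connected C -> C `&` U !=set0 -> C `<=` U.
Proof.
move=> oU oV UV0 CUV cC [x [Cx Ux]].
have [//|CV] := connected_subset (separated_open oU oV UV0) CUV cC.
have : (U `&` V) x by split => //; exact: CV.
by rewrite UV0.
Qed.

(** Relatively clopen subsets of an open set [A] are the open subsets of [A]
    with open difference, so that connectedness of [A] only involves open sets
    of the ambient space; this is the form in which pieces of a cozero set can
    serve as cozero sets themselves. *)
Lemma open_connected_clopen A : open A ->
  (forall U, open U -> open (A `\` U) -> U `<=` A -> U !=set0 -> A `<=` U) ->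
  connected A.
Proof.
move=> oA clopenA _ /[swap] -[U oU ->] AU0 [F cF AUF].
rewrite AUF in AU0 *; apply/seteqP; split; first by move=> ? [].
rewrite -AUF in AU0 *; apply: clopenA => //; first exact: openI.
rewrite AUF setDE setCI setIUr setICr set0U.
by apply: openI => //; exact: closed_openC.
Qed.

(** The closed counterpart: the two pieces are closed in the ambient space,
    hence can be separated by open sets when that space is normal. *)
Lemma closed_not_connected A : closed A -> ~ connected A ->
  exists U V, [/\ closed U /\ closed V, U !=set0, V !=set0,
                  A = U `|` V & U `&` V = set0].
Proof.
move=> cA; apply: contra_notP => noUV B B0 [U oU BU] [F cF BF].
apply/seteqP; split; first by rewrite BF => ? [].
apply: contrapT => nAB.
have AB0 : A `\` B !=set0 by apply/set0P/negP => /eqP; rewrite setD_eq0.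
apply: noUV; exists B, (A `\` B); split => //.
- split; first by rewrite BF; exact: closedI.
  rewrite BU setDE setCI setIUr setICr set0U.
  by apply: closedI => //; exact: open_closedC.
- by rewrite setDUK// BF => ? [].
- by rewrite setDIK.
Qed.

Lemma open_connected_component A x : locally_connected T -> open A ->
  open (connected_component A x).
Proof.
move=> lcT oA; rewrite openE => y Axy.
have Ay : A y by exact: connected_component_sub Axy.
have [V [oV Vy cV VA]] := lcT y A (open_nbhs_nbhs (conj oA Ay)).
rewrite (same_connected_component Axy) /interior.
by apply: filterS (connected_component_max Vy VA cV) _; exact: open_nbhs_nbhs.
Qed.

(** The difference is the union of the other components of [A], which are all
    open. Together with the openness of the component itself, this makes every
    component of an open set relatively clopen. *)
Lemma open_setD_connected_component A x : locally_connected T -> open A ->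
  open (A `\` connected_component A x).
Proof.
move=> lcT oA; rewrite openE => y [Ay nAxy].
have oAy : open (connected_component A y) by exact: open_connected_component.
have Ayy := connected_component_refl Ay.
rewrite /interior; apply: filterS (open_nbhs_nbhs (conj oAy Ayy)) => z Ayz.
split; first exact: connected_component_sub Ayz.
move=> Axz; apply: nAxy; apply: connected_component_trans Axz _.
exact: connected_component_sym.
Qed.

End Topology.

(** * Continuous maps from a compact space to a Hausdorff space *)

Section ClosedMap.
Context {K L : topologicalType} (p : continuousType K L).
Hypotheses (K_compact : compact [set: K]) (L_hausdorff : hausdorff_space L).

Lemma connected_image (C : set K) : connected C -> connected (p @` C).
Proof.
move=> cC; apply: connected_continuous_connected => //.
by apply: continuous_subspaceT => x; exact: cts_fun.
Qed.

Lemma closed_image (F : set K) : closed F -> closed (p @` F).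
Proof.
move=> cF; apply: compact_closed => //; apply: continuous_compact.
  by apply: continuous_subspaceT => x; exact: cts_fun.
by apply: subclosed_compact cF K_compact _.
Qed.

(** [N] is the complement of [p @` (~` U)], which is closed because [p] is a
    closed map. *)
Lemma tube (U : set K) (y : L) : open U -> p @^-1` [set y] `<=` U ->
  exists N, [/\ open N, N y & p @^-1` N `<=` U].
Proof.
move=> oU yU; exists (~` (p @` (~` U))); split.
- exact/closed_openC/closed_image/open_closedC.
- by move=> [x nUx pxy]; apply: nUx; exact: yU.
- by move=> x /= npx; apply: contrapT => nUx; apply: npx; exists x.
Qed.

Hypothesis p_surj : set_surj [set: K] [set: L] p.

Lemma surj_fiber y : exists x, p x = y.
Proof. by have [x _ <-] := p_surj (I : [set: L] y); exists x. Qed.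

Lemma open_preimage_surj (W : set L) : open (p @^-1` W) -> open W.
Proof.
move=> opW; rewrite (_ : W = ~` (p @` (~` (p @^-1` W)))).
  exact/closed_openC/closed_image/open_closedC.
apply/seteqP; split=> [y Wy [x /= nWpx pxy]|y nWy].
  by apply: nWpx; rewrite pxy.
have [x pxy] := surj_fiber y.
by apply: contrapT => nW; apply: nWy; exists x => //=; rewrite pxy.
Qed.

(** [p] is a quotient map, so it is enough that the preimage of a component of
    an open [V] is open: it contains, with a point [x], the whole component of
    [x] in [p @^-1` V], since the image of the latter is connected. *)
Lemma locally_connected_image : locally_connected K -> locally_connected L.
Proof.
move=> lcK y N; rewrite nbhsE => -[V [oV Vy] VN].
exists (connected_component V y); split.
- apply: open_preimage_surj; rewrite openE => x /= Vypx.
  have opV : open (p @^-1` V) by apply: open_comp => // ? _; exact: cts_fun.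
  have pVx : (p @^-1` V) x by exact: connected_component_sub Vypx.
  pose O := connected_component (p @^-1` V) x.
  have oO : open O by exact: open_connected_component.
  have Ox : O x by exact: connected_component_refl.
  rewrite /interior; apply: filterS (open_nbhs_nbhs (conj oO Ox)) => z Oz /=.
  apply: connected_component_trans Vypx _.
  exists (p @` O); last by exists z.
  split; [by exists x| |exact/connected_image/component_connected].
  by move=> _ [t /connected_component_sub Vt <-].
- exact: connected_component_refl.
- exact: component_connected.
- by apply: subset_trans VN; exact: connected_component_sub.
Qed.

(** A relatively clopen part [B] of [p @^-1` C] meets each connected fiber in
    all or nothing, so it is saturated. As [p] is closed, [p @` B] is then
    relatively clopen in [C], whence [p @` B] is [C] and [B] is everything. *)
Lemma monotone_preimage_connected (C : set L) : monotone_map p ->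
  connected C -> connected (p @^-1` C).
Proof.
move=> p_mono cC B [b Bb] [U oU BU] [F cF BF].
have fiberB x x' : B x -> p x = p x' -> B x'.
  move=> Bx pxx'; have Cpx : C (p x) by move: Bx; rewrite BU => -[].
  have BIE G : B = p @^-1` C `&` G ->
      p @^-1` [set p x] `&` B = p @^-1` [set p x] `&` G.
    move=> ->; apply/seteqP; split=> [z [/= -> [_ Gz]]//|z [/= pz Gz]].
    by split => //; split => //=; rewrite pz.
  suff /seteqP[_ /(_ x')] : p @^-1` [set p x] `&` B = p @^-1` [set p x].
    by case.
  apply: p_mono; first by exists x.
    by exists U => //; exact: BIE.
  by exists F => //; exact: BIE.
have pBC : p @` B = C.
  apply: cC; first by exists (p b), b.
  - (* Saturation of [B] keeps [p @` B] off the image of [~` U]. *)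
    exists (~` (p @` (~` U))); first exact/closed_openC/closed_image/open_closedC.
    apply/seteqP; split=> [_ [x Bx <-]|y [Cy npy]].
      split; first by move: Bx; rewrite BU => -[].
      move=> [x' nUx' pxx']; apply: nUx'.
      by have := fiberB x x' Bx (esym pxx'); rewrite BU => -[].
    have [x pxy] := surj_fiber y; exists x => //.
    rewrite BU; split; first by rewrite /= pxy.
    by apply: contrapT => nUx; apply: npy; exists x.
  - exists (p @` F); first exact: closed_image.
    apply/seteqP; split=> [_ [x Bx <-]|y [Cy [x Fx pxy]]].
      by move: Bx; rewrite BF => -[? ?]; split => //; exists x.
    by exists x => //; rewrite BF; split => //=; rewrite pxy.
apply/seteqP; split; first by rewrite BU => ? [].
by move=> x /=; rewrite -pBC => -[z Bz /fiberB]; exact.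
Qed.

End ClosedMap.

(** * Irreducibility in terms of cozero sets *)

Section Cozero.
Context {R : realType} {K : topologicalType}.
Implicit Types (f g h : CFun R K) (U : set K).

Definition cozero f : set K := [set x | f x != 0].

Lemma open_cozero f : open (cozero f).
Proof.
rewrite (_ : cozero f = f @^-1` (~` [set 0])); last first.
  by apply/seteqP; split=> x /= /eqP.
apply: open_comp => [? _|]; first exact: cts_fun.
apply: closed_openC; apply: compact_closed; last exact: compact_set1.
exact: norm_hausdorff.
Qed.

(** Near a point of [U], or of the other open piece of the cozero set, the
    restriction agrees with [f] or with [0]; at a zero of [f] it is dominated
    by [f], which tends to [0] there. *)
Lemma continuous_restrict f U : open U -> open (cozero f `\` U) ->
  U `<=` cozero f -> continuous (f \_ U : K -> R[i]^o).
Proof.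
move=> oU oV Uf x; have fx : f z @[z --> x] --> f x by exact: cts_fun.
have [Ux|nUx] := pselect (U x).
  rewrite /continuous_at patchT ?inE//; apply: cvg_trans fx; apply: near_eq_cvg.
  by apply: filterS (open_nbhs_nbhs (conj oU Ux)) => z Uz; rewrite patchT ?inE.
apply/cvgrPdist_lt => e e0.
have -> : (f \_ U) x = 0 by rewrite patchN// notin_setE.
have [fx0|/negP/negPn/eqP fx0] := pselect (f x != 0).
  have Vx : (cozero f `\` U) x by [].
  apply: filterS (open_nbhs_nbhs (conj oV Vx)) => z [_ nUz].
  by rewrite patchN ?notin_setE// subrr normr0.
move/cvgrPdist_lt : fx => /(_ e e0).
apply: filterS => z; rewrite fx0 !sub0r !normrN; apply: le_lt_trans.
by rewrite /patch; case: ifP => _ //; rewrite normr0.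
Qed.

Definition restrict_cfun f U (oU : open U) (oV : open (cozero f `\` U))
    (Uf : U `<=` cozero f) : CFun R K :=
  mkcts (continuous_restrict oU oV Uf).

Lemma orthogonal_cozeroP f g h : orthogonal_decomposition f g h <->
  f = g \+ h :> (K -> R[i]^o) /\ cozero g `&` cozero h = set0.
Proof.
split=> -[fgh gh]; split => //.
  rewrite -subset0 => x [/= gx hx]; have /orthogonal_funP/(_ x)/eqP := gh.
  by rewrite mulf_eq0 (negbTE gx) (negbTE hx).
apply/orthogonal_funP => x; apply/eqP; rewrite mulf_eq0.
apply: contrapT => /negP; rewrite negb_or => /andP[gx hx].
suff : set0 x by [].
by rewrite -gh.
Qed.

Lemma cozero_orthogonal_decomposition f g h : orthogonal_decomposition f g h ->
  cozero f = cozero g `|` cozero h.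
Proof.
move=> /orthogonal_cozeroP[fgh gh0]; apply/seteqP; split => x; rewrite /cozero/=.
  rewrite fgh /=; have [->|gx] := eqVneq (g x) 0; last by left.
  by rewrite add0r; right.
rewrite fgh /=; case=> [gx|hx].
  suff -> : h x = 0 by rewrite addr0.
  apply/eqP/negPn/negP => hx; suff : set0 x by [].
  by rewrite -gh0.
suff -> : g x = 0 by rewrite add0r.
apply/eqP/negPn/negP => gx; suff : set0 x by [].
by rewrite -gh0.
Qed.

Lemma orthogonal_partE f g h x : orthogonal_decomposition f g h ->
  g x = if g x == 0 then 0 else f x.
Proof.
move=> /orthogonal_cozeroP[-> gh0] /=; case: eqVneq => // gx.
suff -> : h x = 0 by rewrite addr0.
by apply/eqP/negPn/negP => hx; suff : set0 x by []; rewrite -gh0.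
Qed.

Lemma cozero0 f : cozero f = set0 <-> f = cst 0 :> (K -> R[i]^o).
Proof.
split=> [f0|f0]; last by rewrite -subset0 => x; rewrite /cozero f0 /= eqxx.
apply/funext => x; apply/eqP/negPn/negP => fx.
by suff : set0 x by []; rewrite -f0.
Qed.

Lemma cozero_neq0 f : cozero f !=set0 <-> f <> cst 0 :> (K -> R[i]^o).
Proof. by rewrite -cozero0; split=> [/set0P/eqP|/eqP/set0P]. Qed.

(** The orthogonal decompositions of [f] come from splitting its cozero set
    into two open pieces; this is the direction that produces functions. *)
Lemma clopen_orthogonal_decomposition f U : open U -> open (cozero f `\` U) ->
  U `<=` cozero f -> exists g h, [/\ orthogonal_decomposition f g h,
    g = f \_ U :> (K -> R[i]^o), cozero g = U & cozero h = cozero f `\` U].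
Proof.
move=> oU oV Uf.
have cozeroE V (oV' : open V) (oC : open (cozero f `\` V))
    (Vf : V `<=` cozero f) : cozero (restrict_cfun oV' oC Vf) = V.
  apply/seteqP; split=> x; rewrite /cozero /= /restrict_cfun /mkcts /= /patch; case: ifPn => //.
  - by rewrite inE.
  - by rewrite eqxx.
  - by move=> _ /Vf.
  - by rewrite notin_setE.
have oVC : open (cozero f `\` (cozero f `\` U)) by rewrite setDD setIidr.
have Vf : cozero f `\` U `<=` cozero f by move=> ? [].
exists (restrict_cfun oU oV Uf).
exists (restrict_cfun oV oVC Vf); split=> //.
apply/orthogonal_cozeroP; rewrite !cozeroE; split; last by rewrite setDIK.
apply/funext => x; rewrite /= /restrict_cfun /mkcts /= /patch.
have [Ux|nUx] := boolP (x \in U).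
  rewrite ifF ?addr0//; apply/negP; rewrite inE => -[_].
  by apply; rewrite inE in Ux.
rewrite add0r; case: ifPn => //; rewrite notin_setE => nV.
apply/eqP/negPn/negP => fx; apply: nV; split => //.
by rewrite notin_setE in nUx.
Qed.

(** The bridge between algebra and topology: an orthogonal decomposition of
    [f] is a splitting of [cozero f] into two disjoint open sets, which are
    nonempty exactly when the summands are nonzero. *)
Lemma irreducibleP f : irreducible f <-> cozero f !=set0 /\ connected (cozero f).
Proof.
split=> [irrf|[f0 cf] [/cozero0 fE|]]; last 2 first.
- by move: f0; rewrite fE => -[].
- move=> [g [h [fgh /cozero_neq0[x gx] /cozero_neq0[y hy]]]].
  have fE := cozero_orthogonal_decomposition fgh.
  have [_ gh0] := (orthogonal_cozeroP f g h).1 fgh.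
  have fg : cozero f `<=` cozero g.
    apply: (@connected_sub_open _ _ (cozero h)) => //.
    + exact: open_cozero.
    + exact: open_cozero.
    + by rewrite fE.
    + by exists x; rewrite fE; split => //; left.
  suff : set0 y by [].
  by rewrite -gh0; split => //; apply: fg; rewrite fE; right.
split; first by apply/cozero_neq0 => f0; apply: irrf; left.
apply: open_connected_clopen (open_cozero f) _ => U oU oV Uf U0.
have [g [h [fgh _ gE hE]]] := clopen_orthogonal_decomposition oU oV Uf.
apply: contrapT => fU; apply: irrf; right; exists g, h; split => //.
  by apply/cozero_neq0; rewrite gE.
apply/cozero_neq0; rewrite hE; apply/set0P/negP => /eqP.
by rewrite setD_eq0.
Qed.

(** Local connectedness provides irreducible parts: components of a cozero set
    are relatively clopen, so [f] can be cut off outside any of them. *)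
Lemma component_part f x : locally_connected K -> f x != 0 ->
  exists g, irr f g /\ g = f \_ (connected_component (cozero f) x) :> (K -> R[i]^o).
Proof.
move=> lcK fx.
have [g [h [fgh gE cg _]]] := @clopen_orthogonal_decomposition f
  (connected_component (cozero f) x)
  (open_connected_component x lcK (open_cozero f))
  (open_setD_connected_component x lcK (open_cozero f))
  (@connected_component_sub _ _ _).
exists g; split => //; split; last by exists h.
apply/irreducibleP; rewrite cg; split; last exact: component_connected.
by exists x; exact: connected_component_refl.
Qed.

End Cozero.

(** * Irreducible parts in the range of the Koopman operator *)

Lemma urysohn_bump (R : realType) (L : topologicalType) (N : set L) (y : L) :
  compact [set: L] -> hausdorff_space L -> open N -> N y ->
  exists f : CFun R L, f y = 1 /\ cozero f `<=` N.
Proof.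
move=> L_compact L_hausdorff oN Ny.
have y_closed : closed [set y] by apply: compact_closed => //; exact: compact_set1.
have /(@normal_separatorP R) := compact_normal L_hausdorff L_compact.
move=> /(_ (~` N) [set y] (open_closedC oN) y_closed).
case/(_ _)/(@uniform_separatorP _ R).
  by rewrite -subset0 => z [/[swap] ->].
move=> u [u_cts _ u0 u1].
have f_cts : continuous (fun z => (u z)%:C%C : R[i]^o).
  move=> z; apply/cvgrPdist_lt => -[a b] e0.
  move: (e0); rewrite ltcE /= => /andP[/eqP b0 a0].
  have /cvgrPdist_lt/(_ a a0) := u_cts z.
  apply: filterS => t zt; rewrite -rmorphB/= normc_def /= expr0n addr0 sqrtr_sqr.
  by rewrite ltcE /= b0 eqxx.
exists (mkcts f_cts); split.
  have uy : u y = 1 by apply: u1; exists y.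
  by rewrite -[LHS]/((u y)%:C%C) uy.
move=> z; apply: contra_neqP => nNz.
have uz : u z = 0 by apply: u0; exists z.
by rewrite -[LHS]/((u z)%:C%C) uz.
Qed.

Section Koopman.
Context {R : realType} {K L : topologicalType} (p : continuousType K L).
Hypotheses (K_compact : compact [set: K]) (L_hausdorff : hausdorff_space L).
Hypotheses (K_lc : locally_connected K).

(** Let [koopman p f = g + h] with [g] irreducible and [g x != 0]. Since [L] is
    locally connected, the component [W] of [p x] in [cozero f] carries an
    irreducible part [k] of [f]. Then [p @^-1` W] is connected because
    [koopman p k] is irreducible, so it stays in the piece [cozero g] of
    [cozero (koopman p f)]; conversely [p] maps the connected set [cozero g]
    into [W]. Hence [g] is [koopman p k]. *)
Lemma irr_koopman_range (f : CFun R L) g :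
  set_surj [set: K] [set: L] p ->
  (forall f : CFun R L, irreducible f -> irreducible (koopman p f)) ->
  irr (koopman p f) g -> range (@koopman R K L p) g.
Proof.
move=> p_surj p_irr [/irreducibleP[[x gx] cg] [h fgh]].
have L_lc := locally_connected_image K_compact L_hausdorff p_surj K_lc.
have fE := cozero_orthogonal_decomposition fgh.
have [_ gh0] := (orthogonal_cozeroP _ _ _).1 fgh.
have fpx : f (p x) != 0 by have : cozero (koopman p f) x by rewrite fE; left.
have [k [[k_irr _] kE]] := component_part L_lc fpx.
exists k => //; apply/continuousEP => z.
set W := connected_component (cozero f) (p x) in kE.
have cozk : cozero k = W.
  apply/seteqP; split=> t; rewrite /cozero /= kE /patch; case: ifPn => //.
  - by rewrite inE.
  - by rewrite eqxx.
  - by move=> _ /connected_component_sub.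
  - by rewrite notin_setE.
have /p_irr/irreducibleP[_] := k_irr.
rewrite (_ : cozero (koopman p k) = p @^-1` W); last by rewrite -cozk.
move=> cW.
have Wg : p @^-1` W `<=` cozero g.
  apply: (@connected_sub_open _ _ (cozero h)) => //.
  - exact: open_cozero.
  - exact: open_cozero.
  - by rewrite -fE => t /connected_component_sub.
  - by exists x; split => //; exact: connected_component_refl.
have gW : cozero g `<=` p @^-1` W.
  move=> t gt; exists (p @` cozero g); last by exists t.
  split; [by exists x| |exact: connected_image].
  move=> _ [s gs <-].
  by have : cozero (koopman p f) s by rewrite fE; left.
rewrite (orthogonal_partE z fgh) /koopman /= kE /patch.
case: ifPn => [|Wz]; case: eqVneq => //.
- by rewrite inE => gz /Wg; rewrite /cozero /= gz eqxx.
- by move=> gz; rewrite notin_setE in Wz; case: Wz; exact: gW.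
Qed.

(** If the fiber of [y] splits into closed pieces [A] and [B], enclose them in
    disjoint open sets [U] and [V]. A bump function [f] at [y] with small
    support has [cozero (koopman p f)] inside [U `|` V], so its irreducible part
    carried by the component of a point [a] of [A] lives in [U] and vanishes on
    [B]. It takes different values on the fiber of [y], so it does not factor
    through [p]. *)
Lemma irr_range_monotone : hausdorff_space K -> compact [set: L] ->
  irr_set (range (@koopman R K L p)) `<=` range (@koopman R K L p) ->
  monotone_map p.
Proof.
move=> K_hausdorff L_compact irr_range y; apply: contrapT.
have y_closed : closed [set y] by apply: compact_closed => //; exact: compact_set1.
have py_closed : closed (p @^-1` [set y]).
  by apply: preimage_closed => // ? _; exact: cts_fun.
move=> /(closed_not_connected py_closed)[A [B [[cA cB] [a Aa] [b Bb] yE AB0]]].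
have /(@normal_openP R)/(_ A B cA cB AB0) := compact_normal K_hausdorff K_compact.
move=> [U [V [oU oV AU BV UV0]]].
have [] := @tube _ _ p K_compact L_hausdorff (U `|` V) y (openU oU oV).
  by rewrite yE; exact: setUSS.
move=> N [oN Ny NUV].
have [f [fy fN]] := urysohn_bump R L_compact L_hausdorff oN Ny.
have pa : p a = y by have : (p @^-1` [set y]) a by rewrite yE; left.
have pb : p b = y by have : (p @^-1` [set y]) b by rewrite yE; right.
have fa : koopman p f a != 0 by rewrite /koopman /= pa fy oner_neq0.
have [g [g_irr gE]] := component_part K_lc fa.
have [k _ kg] : range (@koopman R K L p) g.
  by apply: irr_range; exists (koopman p f) => //; exists f.
set G := connected_component _ _ in gE.
have Ga : G a by exact: connected_component_refl.
have GU : G `<=` U.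
  apply: (@connected_sub_open _ _ V) => //.
  - by move=> x /connected_component_sub fx; apply: NUV; exact: fN.
  - exact: component_connected.
  - by exists a; split => //; exact: AU.
have nGb : ~ G b.
  by move=> /GU Ub; suff : set0 b by []; rewrite -UV0; split => //; exact: BV.
have : g a = g b by rewrite -kg /koopman /= pa pb.
rewrite gE patchT ?inE// patchN ?notin_setE//.
exact/eqP.
Qed.

End Koopman.

(** * The equivalence *)

Theorem proposition2p4 (R : realType) (K L : topologicalType)
    (K_compact : compact [set: K]) (K_hausdorff : hausdorff_space K)
    (L_compact : compact [set: L]) (L_hausdorff : hausdorff_space L)
    (K_lc : locally_connected K)
    (p : continuousType K L) (p_surj : set_surj [set: K] [set: L] p) :
  [<-> monotone_map p;
       forall C : set L, connected C -> connected (p @^-1` C);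
       forall U : set L, open U -> connected U -> connected (p @^-1` U);
       forall f : CFun R L, irreducible f ->
         connected (p @^-1` [set y | f y != 0]);
       forall f : CFun R L, irreducible f -> irreducible (koopman p f);
       irr_set (range (@koopman R K L p)) `<=` range (@koopman R K L p)].
Proof.
tfae.
- by move=> p_mono C; exact: monotone_preimage_connected.
- by move=> p_conn U _; exact: p_conn.
- move=> p_conn f /irreducibleP[_ cf].
  by apply: p_conn => //; exact: open_cozero.
- move=> p_conn f f_irr; apply/irreducibleP; split; last exact: p_conn.
  have /irreducibleP[[y fy] _] := f_irr.
  by have [x pxy] := surj_fiber p_surj y; exists x; rewrite /cozero /koopman /= pxy.
- by move=> p_irr g [_ [f _ <-]]; exact: irr_koopman_range.
- exact: irr_range_monotone.
Qed.
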